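(* Let $R$ be a right principally projective ring and let $n\geq 2$ be a natural number. Then $R$ is central reduced if and only if $R[x]/(x^n)$ is central Armendariz.
   Context: All rings are associative with identity, not necessarily commutative. A ring $R$ is called central reduced if every nilpotent element of $R$ is central. A ring $R$ is called right principally projective if for every $a\in R$ the right annihilator $\{r\in R: ar=0\}$ is generated by an idempotent, i.e. equals $eR$ for some $e=e^2\in R$. Here $(x^n)$ is the ideal of $R[x]$ generated by $x^n$, where $x$ commutes with coefficients. A ring $S$ is called central Armendariz if whenever $f(y)=\sum_{i=0}^m a_iy^i$ and $g(y)=\sum_{j=0}^s b_jy^j$ in $S[y]$ satisfy $f(y)g(y)=0$, then $a_ib_j$ is a central element of $S$ for all $i$ and $j$. *)

(* Defs.v *)
From HB Require Import structures.
From mathcomp Require Import all_boot all_order all_algebra.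
From mathcomp Require Import generic_quotient ring_quotient.
From mathcomp Require Import boolp.

Set Implicit Arguments.
Unset Strict Implicit.
Unset Printing Implicit Defensive.

Import GRing.Theory.
Local Open Scope ring_scope.
Local Open Scope quotient_scope.

Definition central (R : pzRingType) (x : R) : Prop :=
  forall y : R, x * y = y * x.

Definition nilpotent_elt (R : pzRingType) (x : R) : Prop :=
  exists k : nat, x ^+ k = 0.

Definition central_reduced (R : pzRingType) : Prop :=
  forall x : R, nilpotent_elt x -> central x.

Definition right_principally_projective (R : pzRingType) : Prop :=
  forall a : R, exists e : R, e = e * e /\
    (forall r : R, a * r = 0 <-> exists s : R, r = e * s).

(* Quantifying over all i and j is harmless: coefficients of index at least
   the size of a polynomial are 0. *)
Definition central_armendariz (S : nzRingType) : Prop :=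
  forall f g : {poly S}, f * g = 0 ->
  forall i j : nat, central (f`_i * g`_j).

(* MathComp only provides the ring structure of {ideal_quot I} and of
   {poly %/ p} over commutative rings, hence the following construction of
   the quotient of an arbitrary ring by a principal two-sided ideal. *)
Section PrincipalIdealQuotient.
Variables (A : nzRingType) (a : A).

Definition principal_ideal : {pred A} := fun x =>
  `[< exists s : seq (A * A), x = \sum_(uv <- s) uv.1 * a * uv.2 >].

Lemma principal_idealP x :
  reflect (exists s : seq (A * A), x = \sum_(uv <- s) uv.1 * a * uv.2)
          (x \in principal_ideal).
Proof. exact: asboolP. Qed.

Lemma principal_idealMl x y :
  y \in principal_ideal -> x * y \in principal_ideal.
Proof.
move=> /principal_idealP[s ->]; apply/principal_idealP.
exists [seq (x * uv.1, uv.2) | uv <- s].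
by rewrite big_map mulr_sumr; apply: eq_bigr => uv _; rewrite /= !mulrA.
Qed.

Lemma principal_idealMr x y :
  x \in principal_ideal -> x * y \in principal_ideal.
Proof.
move=> /principal_idealP[s ->]; apply/principal_idealP.
exists [seq (uv.1, uv.2 * y) | uv <- s].
by rewrite big_map mulr_suml; apply: eq_bigr => uv _; rewrite /= !mulrA.
Qed.

Fact principal_ideal_zmod_closed : zmod_closed principal_ideal.
Proof.
split=> [|x y xI yI].
  by apply/principal_idealP; exists [::]; rewrite big_nil.
have /principal_idealP[t Dt] := principal_idealMl (-1) yI.
have /principal_idealP[s Ds] := xI.
by apply/principal_idealP; exists (s ++ t); rewrite big_cat -Ds -Dt mulN1r.
Qed.

HB.instance Definition _ :=
  GRing.isZmodClosed.Build A principal_ideal principal_ideal_zmod_closed.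

Definition quotient_ring : Type := {ideal_quot principal_ideal}.

HB.instance Definition _ := GRing.Zmodule.on quotient_ring.
HB.instance Definition _ :=
  EqQuotient.copy quotient_ring {ideal_quot principal_ideal}.

Lemma quotient_ring_eqP (x y : A) :
  reflect (\pi_quotient_ring x = \pi_quotient_ring y)
          (x - y \in principal_ideal).
Proof. by rewrite Quotient.idealrBE; exact: eqP. Qed.

Definition quotient_one : quotient_ring := \pi_quotient_ring 1.
Definition quotient_mul (u v : quotient_ring) : quotient_ring :=
  \pi_quotient_ring (repr u * repr v).

Lemma quotient_pi_zero : \pi_quotient_ring 0 = 0.
Proof. exact: (@pi_zeror _ _ _ _ _ {ideal_quot principal_ideal}). Qed.

Lemma quotient_pi_add :
  {morph \pi_quotient_ring : x y / x + y >-> x + y}.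
Proof. exact: Quotient.pi_add. Qed.

Lemma quotient_pi_mul :
  {morph \pi_quotient_ring : x y / x * y >-> quotient_mul x y}.
Proof.
move=> x y; apply/quotient_ring_eqP.
set x' := repr _; set y' := repr _.
have xI : x - x' \in principal_ideal by apply/quotient_ring_eqP; rewrite reprK.
have yI : y - y' \in principal_ideal by apply/quotient_ring_eqP; rewrite reprK.
have -> : x * y - x' * y' = (x - x') * y + x' * (y - y').
  by rewrite mulrBl mulrBr addrA subrK.
by apply: rpredD; [exact: principal_idealMr | exact: principal_idealMl].
Qed.

Fact quotient_mulA : associative quotient_mul.
Proof.
elim/quotW=> x; elim/quotW=> y; elim/quotW=> z.
rewrite -(quotient_pi_mul y z) -(quotient_pi_mul x (y * z)).
by rewrite -(quotient_pi_mul x y) -(quotient_pi_mul (x * y) z) mulrA.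
Qed.

Fact quotient_mul1l : left_id quotient_one quotient_mul.
Proof. by elim/quotW=> x; rewrite -(quotient_pi_mul 1 x) mul1r. Qed.

Fact quotient_mul1r : right_id quotient_one quotient_mul.
Proof. by elim/quotW=> x; rewrite -(quotient_pi_mul x 1) mulr1. Qed.

Fact quotient_mulDl : left_distributive quotient_mul +%R.
Proof.
elim/quotW=> x; elim/quotW=> y; elim/quotW=> z.
rewrite -(quotient_pi_add x y) -(quotient_pi_mul x z) -(quotient_pi_mul y z).
by rewrite -(quotient_pi_mul (x + y) z) -quotient_pi_add mulrDl.
Qed.

Fact quotient_mulDr : right_distributive quotient_mul +%R.
Proof.
elim/quotW=> x; elim/quotW=> y; elim/quotW=> z.
rewrite -(quotient_pi_add y z) -(quotient_pi_mul x y) -(quotient_pi_mul x z).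
by rewrite -(quotient_pi_mul x (y + z)) -quotient_pi_add mulrDr.
Qed.

HB.instance Definition _ := GRing.Zmodule_isPzRing.Build quotient_ring
  quotient_mulA quotient_mul1l quotient_mul1r quotient_mulDl quotient_mulDr.

Lemma quotient_ring_neq0 :
  1 \notin principal_ideal -> (1 : quotient_ring) != 0.
Proof.
apply: contra => /eqP q10; rewrite -[1]subr0.
by apply/quotient_ring_eqP; rewrite [LHS]q10 [RHS]quotient_pi_zero.
Qed.

End PrincipalIdealQuotient.

(* Positivity of n makes the quotient R[x]/(x^n) nonzero, which is needed to
   form the MathComp polynomials over it. *)
Section TruncatedPolynomials.
Variables (R : nzRingType) (n : nat) (n_gt0 : (0 < n)%N).

Lemma mem_principal_idealXn (p : {poly R}) :
  p \in principal_ideal 'X^n -> forall i, (i < n)%N -> p`_i = 0.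
Proof.
move=> /principal_idealP[s ->] i lt_in; rewrite coef_sum big1 // => uv _.
by rewrite -mulrA -commr_polyXn mulrA coefMXn lt_in.
Qed.

Definition polyXn_quotient of (0 < n)%N : Type :=
  quotient_ring ('X^n : {poly R}).

HB.instance Definition _ := GRing.PzRing.on (polyXn_quotient n_gt0).

Fact polyXn_quotient_neq0 : (1 : polyXn_quotient n_gt0) != 0.
Proof.
apply: quotient_ring_neq0; apply/negP => /mem_principal_idealXn/(_ 0%N n_gt0).
by rewrite coef1 => /eqP; rewrite oner_eq0.
Qed.

HB.instance Definition _ :=
  GRing.PzSemiRing_isNonZero.Build (polyXn_quotient n_gt0) polyXn_quotient_neq0.

End TruncatedPolynomials.

Arguments polyXn_quotient R {n} n_gt0.

(* Main.v *)
Require Import Defs.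
From mathcomp Require Import all_boot all_order all_algebra.
From mathcomp Require Import generic_quotient.

(* For a right principally projective ring [R], both conditions force [R] to
   be reduced: if a^2 = 0 and ann(a) = eR, then a = ea and ae = 0, so a = 0 as
   soon as a and e commute.  They commute when a is central (R central
   reduced), and also when e is central: in a central Armendariz ring the
   product (e - er(1-e)y)((1-e) + er(1-e)y) = 0 shows that er(1-e) is central,
   hence 0, so that idempotents are central.
   Conversely, if R is reduced then so is R[y], and (R[x]/(x^n))[y] is
   R[y][x]/(x^n); in a reduced ring, the vanishing of the convolutions
   \sum_(k + l = m) F_k G_l for m < n yields F_k G_l = 0 for k + l < n.  Applied
   over R[y] and then over R, this gives a_i b_j = 0. *)

Set Implicit Arguments.
Unset Strict Implicit.
Unset Printing Implicit Defensive.

Import GRing.Theory.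
Local Open Scope ring_scope.
Local Open Scope quotient_scope.

Definition reduced (R : pzRingType) : Prop :=
  forall x : R, x * x = 0 -> x = 0.

Lemma reduced_nilpotent (R : pzRingType) (x : R) :
  reduced R -> nilpotent_elt x -> x = 0.
Proof.
move=> redR [k xk0].
(* Padding the exponent to a power of two lets each use of reducedness halve it. *)
have: x ^+ (2 ^ k) = 0.
  by rewrite -(subnK (ltnW (ltn_expl k (ltnSn 1)))) exprD xk0 mulr0.
elim: k {xk0} => [|k IHk]; first by rewrite expr1.
by rewrite expnSr exprM expr2 => /redR.
Qed.

Lemma reduced_central_reduced (R : pzRingType) :
  reduced R -> central_reduced R.
Proof.
by move=> redR x /(reduced_nilpotent redR)-> y; rewrite mul0r mulr0.
Qed.

(** Asking only that [a] and [e] commute serves both directions: [a] is central in one, [e] in the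
    other. *)
Lemma rpp_reduced (R : pzRingType) :
    right_principally_projective R ->
    (forall a e : R, a * a = 0 -> e * e = e -> a * e = e * a) ->
  reduced R.
Proof.
move=> rppR comm_ae a aa0; have [e [idem_e annP]] := rppR a.
have [s a_es] := (annP a).1 aa0.
have ae0 : a * e = 0 by apply/annP; exists 1; rewrite mulr1.
by rewrite a_es {1}idem_e -mulrA -a_es -comm_ae.
Qed.

Lemma central_armendariz_idem_corner (S : nzRingType) (e r : S) :
  central_armendariz S -> e * e = e -> e * r * (1 - e) = 0.
Proof.
move=> armS idem_e; set d := e * r * (1 - e).
have ed : e * d = d by rewrite /d !mulrA idem_e.
have e'e : (1 - e) * e = 0 by rewrite mulrBl mul1r idem_e subrr.
have ee' : e * (1 - e) = 0 by rewrite mulrBr mulr1 idem_e subrr.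
have de : d * e = 0 by rewrite /d -mulrA e'e mulr0.
have dd : d * d = 0 by rewrite -{2}ed mulrA de mul0r.
have fg0 : (e%:P - d%:P * 'X) * ((1 - e)%:P + d%:P * 'X) = 0.
  have monomialM c : d%:P * 'X * c%:P = (d * c)%:P * 'X.
    by rewrite -mulrA -commr_polyX mulrA (polyCM d).
  rewrite mulrDr !mulrBl !mulrA !monomialM -!polyCM ee' ed dd mulrBr mulr1 de.
  by rewrite subr0 !mul0r sub0r subr0 addNr.
(* The product of coefficients 0 and 1 is [e * d = d]; commuting it with [e] gives
   [d = e * d = d * e = 0]. *)
have := armS _ _ fg0 0%N 1%N e.
by rewrite !coefE /= ?(mulr0, subr0, add0r, mulr1) ed de ed.
Qed.

Lemma central_armendariz_idem_central (S : nzRingType) (e : S) :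
  central_armendariz S -> e * e = e -> central e.
Proof.
move=> armS idem_e r.
(* The corners for [e] and [1 - e] give er = ere and re = ere. *)
have /eqP := central_armendariz_idem_corner r armS idem_e.
have idem_e' : (1 - e) * (1 - e) = 1 - e.
  by rewrite mulrBr mulr1 [_ * e]mulrBl mul1r idem_e subrr subr0.
have /eqP := central_armendariz_idem_corner r armS idem_e'.
rewrite subKr mulrBl mul1r mulrBl mulrBr mulr1 !subr_eq0.
by move=> /eqP-> /eqP.
Qed.

Lemma reduced_reversible (R : pzRingType) (a b : R) :
  reduced R -> a * b = 0 -> b * a = 0.
Proof.
by move=> redR ab0; apply: redR; rewrite mulrA -(mulrA b) ab0 mulr0 mul0r.
Qed.

Lemma reduced_convolution (T : pzRingType) (n : nat) (F G : nat -> T) :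
    reduced T ->
    (forall m, (m < n)%N -> \sum_(k < m.+1) F k * G (m - k)%N = 0) ->
  forall k l, (k + l < n)%N -> F k * G l = 0.
Proof.
move=> redT conv0.
have main m : (m < n)%N -> forall k, (k <= m)%N -> F k * G (m - k)%N = 0.
  elim/ltn_ind: m => m IHm lt_mn; elim/ltn_ind=> k IHk le_km.
  (* Multiplying the convolution by F_k on the right kills all other terms. *)
  suff FGF : F k * G (m - k)%N * F k = 0.
    by apply: redT; rewrite mulrA FGF mul0r.
  have := congr1 ( *%R^~ (F k)) (conv0 m lt_mn).
  rewrite /= mul0r mulr_suml (bigD1 (Ordinal (le_km : (k < m.+1)%N))) //=.
  rewrite big1 ?addr0 // => -[i /= lt_im]; rewrite -val_eqE /= => neq_ik.
  case: (ltngtP i k) neq_ik => // [lt_ik|lt_ki] _.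
    by rewrite IHk ?mul0r // -ltnS.
  (* For i > k, the factor [G (m - i) * F k] vanishes: reversed, it has total degree k + (m - i) <
     m. *)
  rewrite -mulrA (@reduced_reversible _ (F k)) ?mulr0 //.
  have lt_m : (k + (m - i) < m)%N.
    by rewrite -{2}(subnKC (lt_im : (i <= m)%N)) ltn_add2r.
  rewrite -{1}(addKn k (m - i)%N); apply: IHm => //; last exact: leq_addr.
  exact: ltn_trans lt_mn.
by move=> k l lt_kl; have := main _ lt_kl k (leq_addr _ _); rewrite addKn.
Qed.

Lemma reduced_armendariz (R : nzRingType) (p q : {poly R}) :
  reduced R -> p * q = 0 -> forall i j, p`_i * q`_j = 0.
Proof.
move=> redR pq0 i j.
apply: (@reduced_convolution _ (i + j).+1 (nth 0 p) (nth 0 q)) => // m _.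
by rewrite -coefM pq0 coef0.
Qed.

Lemma reduced_poly (R : nzRingType) : reduced R -> reduced {poly R}.
Proof.
move=> redR p pp0; apply/polyP=> i; rewrite coef0.
exact/redR/reduced_armendariz.
Qed.

Section TruncatedCoefficients.
Variables (R : nzRingType) (n : nat) (n_gt0 : (0 < n)%N).
Local Notation S := (polyXn_quotient R n_gt0).

Definition truncX (p : {poly R}) : S := \pi_(quotient_ring 'X^n) p.

(* The coefficient of x^k in an element of R[x]/(x^n), meaningful for k < n
   only: for k >= n it depends on the choice of representatives. *)
Definition trunc_coef (k : nat) (s : S) : R :=
  (repr (s : quotient_ring 'X^n))`_k.

Lemma truncX_mul p q : truncX (p * q) = truncX p * truncX q.
Proof. exact: quotient_pi_mul. Qed.

Lemma truncX0 : truncX 0 = 0.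
Proof. exact: quotient_pi_zero. Qed.

Lemma truncX_add p q : truncX (p + q) = truncX p + truncX q.
Proof. exact: quotient_pi_add. Qed.

Lemma truncX_repr (s : S) : truncX (repr (s : quotient_ring 'X^n)) = s.
Proof. exact: reprK. Qed.

Lemma trunc_coefX k p : (k < n)%N -> trunc_coef k (truncX p) = p`_k.
Proof.
move=> lt_kn; apply/eqP; rewrite -subr_eq0 -coefB; apply/eqP.
apply: mem_principal_idealXn lt_kn.
by apply/quotient_ring_eqP; rewrite reprK.
Qed.

Lemma trunc_coef0 k : (k < n)%N -> trunc_coef k 0 = 0.
Proof. by move=> lt_kn; rewrite -truncX0 trunc_coefX // coef0. Qed.

Lemma trunc_coef_sum k (I : finType) (s : I -> S) : (k < n)%N ->
  trunc_coef k (\sum_i s i) = \sum_i trunc_coef k (s i).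
Proof.
(* The sum of the representatives represents the sum, though it need not be the one chosen by
   [repr]. *)
move=> lt_kn; rewrite -coef_sum -(trunc_coefX _ lt_kn).
rewrite (big_morph _ truncX_add truncX0); congr trunc_coef.
by apply: eq_bigr => i _; rewrite truncX_repr.
Qed.

Lemma trunc_coefM m (s t : S) : (m < n)%N ->
  trunc_coef m (s * t)
    = \sum_(k < m.+1) trunc_coef k s * trunc_coef (m - k)%N t.
Proof.
move=> lt_mn; rewrite -{1}(truncX_repr s) -{1}(truncX_repr t) -truncX_mul.
by rewrite trunc_coefX // coefM.
Qed.

Lemma trunc_coef_eq0 (s : S) :
  (forall k, (k < n)%N -> trunc_coef k s = 0) -> s = 0.
Proof.
move=> s0; rewrite -(truncX_repr s) -truncX0.
apply/quotient_ring_eqP; rewrite subr0; apply/principal_idealP.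
(* With no terms below degree n, [p] equals [drop_poly n p * 'X^n]. *)
set p := repr _; exists [:: (drop_poly n p, 1)].
rewrite big_seq1 /= mulr1 -{1}(poly_take_drop n p) -[RHS]add0r; congr (_ + _).
apply/polyP=> k; rewrite coef_take_poly coef0.
by case: ifP => // /s0.
Qed.

(** Lets centrality descend from the quotient to R. *)
Lemma truncXC_inj : injective (fun c : R => truncX c%:P).
Proof.
by move=> c d /(congr1 (trunc_coef 0)); rewrite !trunc_coefX // !coefC eqxx.
Qed.

Lemma trunc_reduced_armendariz (f g : {poly S}) :
  reduced R -> f * g = 0 -> forall i j, f`_i * g`_j = 0.
Proof.
move=> redR fg0.
(* [slice h k] in R[y] is the coefficient of x^k once [h] is read as a truncated polynomial in x
   over R[y]. *)
pose slice (h : {poly S}) k : {poly R} := map_poly (trunc_coef k) h.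
have coef_slice h k i : (k < n)%N -> (slice h k)`_i = trunc_coef k h`_i.
  by move=> lt_kn; rewrite coef_map_id0 ?trunc_coef0.
have slice_mul0 k l : (k + l < n)%N -> slice f k * slice g l = 0.
  apply: reduced_convolution; first exact: reduced_poly.
  move=> m lt_mn; apply/polyP=> j; rewrite coef0 coef_sum.
  (* Exchanging the sums over powers of x and of y identifies the convolution of slices with a slice
     of [f * g]. *)
  transitivity (trunc_coef m (f * g)`_j).
    rewrite coefM trunc_coef_sum //.
    under [RHS]eq_bigr => i _ do rewrite trunc_coefM //.
    rewrite exchange_big /=; apply: eq_bigr => k1 _.
    rewrite coefM; apply: eq_bigr => i _.
    rewrite !coef_slice //; first exact: leq_ltn_trans (leq_subr _ _) lt_mn.
    by apply: leq_trans lt_mn; exact: ltn_ord.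
  by rewrite fg0 coef0 trunc_coef0.
move=> i j; apply: trunc_coef_eq0 => m lt_mn.
rewrite trunc_coefM // big1 // => k _.
have le_km : (k <= m)%N by rewrite -ltnS.
(* Each term is now a product of coefficients of two slices with product 0, so the Armendariz
   property of R applies. *)
rewrite -!coef_slice.
- by apply/reduced_armendariz/slice_mul0; rewrite ?subnKC.
- exact: leq_ltn_trans (leq_subr _ _) lt_mn.
- exact: leq_ltn_trans le_km lt_mn.
Qed.

Lemma trunc_armendariz_idem_central (e : R) :
  central_armendariz S -> e * e = e -> central e.
Proof.
move=> armS idem_e r; apply: truncXC_inj; rewrite /= !polyCM !truncX_mul.
apply: central_armendariz_idem_central => //.
by rewrite -truncX_mul -polyCM idem_e.
Qed.

End TruncatedCoefficients.

Theorem theorem2p30 (R : nzRingType) (n : nat) (n_ge2 : (2 <= n)%N)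
    (R_rpp : right_principally_projective R) :
  central_reduced R <-> central_armendariz (polyXn_quotient R (ltnW n_ge2)).
Proof.
split=> [cenR | armS].
  have redR : reduced R.
    apply: rpp_reduced => // a e aa0 _; apply: cenR.
    by exists 2; rewrite expr2.
  move=> f g fg0 i j s.
  by rewrite trunc_reduced_armendariz // mul0r mulr0.
apply/reduced_central_reduced/rpp_reduced => // a e _ idem_e.
by rewrite (trunc_armendariz_idem_central armS idem_e).
Qed.
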